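(* Let $G=G(I,P;E)$ be an arbitrary Assur graph. Then there is a configuration $\mathbf p$ of $I\cup P$ in $\mathbb R^2$ (with distinct positions for the pinned vertices) such that: (1) the pinned framework $G(\mathbf p)$ has a one-dimensional space of self-stresses, spanned by a self-stress which is non-zero on every edge; and (2) $G(\mathbf p)$ has, up to scalar multiples, a unique non-trivial first-order motion (with the pinned vertices fixed), and this motion assigns a non-zero velocity to every inner vertex.
   Context: A pinned graph $G(I,P;E)$ has a set $I$ of inner vertices, a set $P$ of pinned vertices, and edge set $E$ in which every edge has at least one endpoint in $I$. A pinned framework $G(\mathbf p)$ places all vertices at points of $\mathbb R^2$, pinned vertices regarded as fixed. A first-order motion assigns $\mathbf p'_i\in\mathbb R^2$ to inner vertices ($\mathbf p'_v=\mathbf 0$ for $v\in P$) with $(\mathbf p_i-\mathbf p_j)\cdot(\mathbf p'_i-\mathbf p'_j)=0$ for all edges $ij$. A self-stress is an assignment of scalars $\lambda_{ij}$ to edges with $\sum_{j:ij\in E}\lambda_{ij}(\mathbf p_i-\mathbf p_j)=\mathbf 0$ at every inner vertex $i$ (a row dependency of the $|E|\times 2|I|$ pinned rigidity matrix). Pinned Framework Conditions: $|E|=2|I|$ and for every subgraph $G'(I',P';E')$ with $E'\ne\emptyset$: $|E'|\le 2|I'|$ if $|P'|\ge2$, $|E'|\le 2|I'|-1$ if $|P'|=1$, $|E'|\le 2|I'|-3$ if $P'=\emptyset$; graphs satisfying these are called pinned isostatic. A rigidity circuit is a (multi)graph with edge set $C$, $|C|=2|V(C)|-2$, and every nonempty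 proper subset $F$ satisfies $|F|\le 2|V(F)|-3$. An Assur graph is a pinned isostatic graph such that identifying all pinned vertices to a single vertex (keeping all edges) yields a rigidity circuit. *)

(* Defs.v *)
From Stdlib Require Import Reals.
From mathcomp Require Import all_boot.
Set Implicit Arguments. Unset Strict Implicit. Unset Printing Implicit Defensive.

(* A pinned (multi)graph G(I,P;E): finite types of inner vertices I, pinned
   vertices P, edges E; each edge e has endpoints src e, dst e in I + P. *)

Definition pinned_graph (I P E : finType) (src dst : E -> I + P) : Prop :=
  forall e : E, is_inl (src e) || is_inl (dst e).

Definition in_vs (I P : finType) (I' : {set I}) (P' : {set P}) (v : I + P) : bool :=
  match v with inl i => i \in I' | inr p => p \in P' end.

Definition is_subgraph (I P E : finType) (src dst : E -> I + P)
  (I' : {set I}) (P' : {set P}) (E' : {set E}) : Prop :=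
  forall e, e \in E' -> in_vs I' P' (src e) && in_vs I' P' (dst e).

(* Pinned Framework Conditions (pinned isostatic), nat arithmetic with the
   constants moved to the left to avoid truncated subtraction. *)
Definition pinned_isostatic (I P E : finType) (src dst : E -> I + P) : Prop :=
  pinned_graph src dst /\
  #|E| = 2 * #|I| /\
  forall (I' : {set I}) (P' : {set P}) (E' : {set E}),
    E' != set0 -> is_subgraph src dst I' P' E' ->
    (2 <= #|P'| -> #|E'| <= 2 * #|I'|) /\
    (#|P'| = 1 -> #|E'| + 1 <= 2 * #|I'|) /\
    (#|P'| = 0 -> #|E'| + 3 <= 2 * #|I'|).

Definition collapse (I P : finType) (v : I + P) : option I :=
  match v with inl i => Some i | inr _ => None end.

Definition span_vs (V E : finType) (s t : E -> V) (F : {set E}) : {set V} :=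
  [set v | [exists e in F, (s e == v) || (t e == v)]].

Definition rigidity_circuit (V E : finType) (s t : E -> V) : Prop :=
  #|E| + 2 = 2 * #|span_vs s t [set: E]| /\
  forall F : {set E}, F != set0 -> F \proper [set: E] ->
    #|F| + 3 <= 2 * #|span_vs s t F|.

Definition assur_graph (I P E : finType) (src dst : E -> I + P) : Prop :=
  pinned_isostatic src dst /\
  rigidity_circuit (fun e => collapse (src e)) (fun e => collapse (dst e)).

Definition pt := (R * R)%type.
Definition psub (a b : pt) : pt := (Rminus a.1 b.1, Rminus a.2 b.2).
Definition padd (a b : pt) : pt := (Rplus a.1 b.1, Rplus a.2 b.2).
Definition pdot (a b : pt) : R := Rplus (Rmult a.1 b.1) (Rmult a.2 b.2).
Definition pscale (c : R) (a : pt) : pt := (Rmult c a.1, Rmult c a.2).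
Definition pzero : pt := (R0, R0).

Definition vel (I P : finType) (m : I -> pt) (v : I + P) : pt :=
  match v with inl i => m i | inr _ => pzero end.

Definition is_motion (I P E : finType) (src dst : E -> I + P)
  (p : I + P -> pt) (m : I -> pt) : Prop :=
  forall e : E,
    pdot (psub (p (src e)) (p (dst e)))
         (psub (vel m (src e)) (vel m (dst e))) = R0.

Definition edge_dir (I P E : finType) (src dst : E -> I + P)
  (p : I + P -> pt) (v : I + P) (e : E) : pt :=
  padd (if src e == v then psub (p (src e)) (p (dst e)) else pzero)
       (if dst e == v then psub (p (dst e)) (p (src e)) else pzero).

Definition is_stress (I P E : finType) (src dst : E -> I + P)
  (p : I + P -> pt) (w : E -> R) : Prop :=
  forall i : I,
    \big[Rplus/R0]_(e : E) (Rmult (w e) (edge_dir src dst p (inl i) e).1) = R0 /\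
    \big[Rplus/R0]_(e : E) (Rmult (w e) (edge_dir src dst p (inl i) e).2) = R0.

(* Main.v *)
Require Import Defs.
From Stdlib Require Import Reals FunctionalExtensionality.
From mathcomp Require Import all_boot all_order all_algebra.
From mathcomp Require Import Rstruct zify ring.
Set Implicit Arguments. Unset Strict Implicit. Unset Printing Implicit Defensive.
Import GRing.Theory Num.Theory.
Local Open Scope ring_scope.

(** Collapse the pins to one vertex, placed at the origin. The resulting rigidity
    circuit has a generic drawing [m] whose edges carry a stress [w], unique up to
    scale and nonzero on every edge; since the system is square, the rotation of
    [m] about the origin is its only motion fixing the pin. Stresses and motions
    depend only on edge directions, so it suffices to redraw the graph with
    distinct pins and with edges parallel to those of [m]: by linear algebra this
    is possible as soon as the pins satisfy the single linear equation dual to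
    [w]. The existence of [m] is Laman's theorem for the circuit minus an edge,
    obtained from Whiteley's argument on drawings with prescribed directions;
    the independence of generic directions comes from Rado's exchange argument
    applied to the planes spanned by the edges. *)

(** * Linear algebra of square systems, in particular of corank one *)

Section SquareSystems.
Variables (K : fieldType) (E J : finType).
Implicit Types A : E -> J -> K.

Definition left_ker A (w : E -> K) := forall j, \sum_e w e * A e j = 0.
Definition right_ker A (x : J -> K) := forall e, \sum_j A e j * x j = 0.
Definition left_indep A := forall w, left_ker A w -> forall e, w e = 0.

Lemma big_enum_val_cast (n : nat) (T : finType) (h : n = #|T|) (F : T -> K) :
  \sum_x F x = \sum_(i < n) F (enum_val (cast_ord h i)).
Proof.
subst n; rewrite (big_enum_val F).
by apply: eq_bigr => i _; rewrite cast_ord_id.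
Qed.

Lemma left_right_ker A (w : E -> K) (x : J -> K) :
  \sum_e w e * (\sum_j A e j * x j) = \sum_j (\sum_e w e * A e j) * x j.
Proof.
under eq_bigr do rewrite mulr_sumr.
rewrite exchange_big /=; apply: eq_bigr => j _.
by rewrite mulr_suml; apply: eq_bigr => e _; rewrite mulrA.
Qed.

Hypothesis EJ : #|E| = #|J|.

Definition sqmx A : 'M[K]_#|E| :=
  \matrix_(i, j) A (enum_val i) (enum_val (cast_ord EJ j)).

Lemma sqmx_left_ker A : \det (sqmx A) = 0 <->
  exists2 w, left_ker A w & exists e, w e != 0.
Proof.
split=> [/eqP/det0P [v v0 vA] | [w wA [e we]]].
  exists (fun e => v 0 (enum_rank e)).
    move=> j; move/matrixP/(_ 0 (cast_ord (esym EJ) (enum_rank j))): vA.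
    rewrite !mxE (big_enum_val (fun e => v 0 (enum_rank e) * A e j)) => h; rewrite -[RHS]h.
    apply: eq_bigr => i _.
    by rewrite !mxE cast_ordKV enum_rankK enum_valK.
  case/rV0Pn: v0 => i vi; exists (enum_val i).
  by rewrite enum_valK.
apply/eqP/det0P; exists (\row_i w (enum_val i)).
  by apply/rV0Pn; exists (enum_rank e); rewrite mxE enum_rankK.
apply/rowP => j; rewrite !mxE -[RHS](wA (enum_val (cast_ord EJ j))) [RHS]big_enum_val.
by apply: eq_bigr => i _; rewrite !mxE.
Qed.

Lemma sqmx_right_ker A : \det (sqmx A) = 0 <->
  exists2 x, right_ker A x & exists j, x j != 0.
Proof.
rewrite -det_tr; split=> [/eqP/det0P [v v0 vA] | [x xA [j xj]]].
  exists (fun j => v 0 (cast_ord (esym EJ) (enum_rank j))).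
    move=> e; move/matrixP/(_ 0 (enum_rank e)): vA.
    rewrite !mxE (big_enum_val_cast EJ) => h; rewrite -[RHS]h.
    apply: eq_bigr => i _.
    by rewrite !mxE enum_rankK enum_valK cast_ordK mulrC.
  case/rV0Pn: v0 => i vi; exists (enum_val (cast_ord EJ i)).
  by rewrite enum_valK cast_ordK.
apply/eqP/det0P; exists (\row_i x (enum_val (cast_ord EJ i))).
  apply/rV0Pn; exists (cast_ord (esym EJ) (enum_rank j)).
  by rewrite mxE cast_ordKV enum_rankK.
apply/rowP => i; rewrite !mxE -[RHS](xA (enum_val i)) [RHS](big_enum_val_cast EJ).
by apply: eq_bigr => k _; rewrite !mxE mulrC.
Qed.

Lemma left_indepP A : left_indep A <-> \det (sqmx A) != 0.
Proof.
split=> [iA | dA w wA e].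
  by apply/eqP => /sqmx_left_ker [w wA [e]]; rewrite iA ?eqxx.
by apply: contraNeq dA => we; apply/eqP/sqmx_left_ker; exists w; last exists e.
Qed.

Lemma left_indep_right_ker A x : left_indep A -> right_ker A x -> forall j, x j = 0.
Proof.
move=> /left_indepP dA xA j; apply: contraNeq dA => xj.
by apply/eqP/sqmx_right_ker; exists x; last exists j.
Qed.

Lemma left_indep_solve A (b : E -> K) :
  left_indep A -> exists x, forall e, \sum_j A e j * x j = b e.
Proof.
move=> /left_indepP dA.
have uA : sqmx A \in unitmx by rewrite unitmxE unitfE.
pose v := invmx (sqmx A) *m \col_i b (enum_val i).
exists (fun j => v (cast_ord (esym EJ) (enum_rank j)) 0) => e.
have /matrixP/(_ (enum_rank e) 0) : sqmx A *m v = \col_i b (enum_val i).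
  by rewrite mulKVmx.
rewrite !mxE enum_rankK => <-; rewrite (big_enum_val_cast EJ).
by apply: eq_bigr => i _; rewrite !mxE enum_rankK enum_valK cast_ordK.
Qed.

Definition set_row A f (r : J -> K) : E -> J -> K :=
  fun e j => if e == f then r j else A e j.

Lemma sum_set_row A f r w j :
  \sum_e w e * set_row A f r e j = w f * r j + \sum_(e | e != f) w e * A e j.
Proof.
rewrite (bigD1 f) //= /set_row eqxx; congr (_ + _).
by apply: eq_bigr => e /negbTE ->.
Qed.

Section Corank1.
Variables (A : E -> J -> K) (f : E) (j0 : J) (x0 : J -> K).
Hypothesis x0A : right_ker A x0.
Hypothesis x0j : x0 j0 != 0.
Hypothesis indf : forall w, w f = 0 -> left_ker A w -> forall e, w e = 0.

Let B := set_row A f (fun j => (j == j0)%:R).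

(** Pairing a dependency of [B] with [x0] kills every row but [f] and leaves [w f * x0 j0 = 0]; so
    [w f = 0] and [indf] applies. *)
Lemma set_row_left_indep : left_indep B.
Proof.
move=> w wB.
have wBx : \sum_j (\sum_e w e * B e j) * x0 j = w f * x0 j0.
  rewrite -left_right_ker (bigD1 f) //= [X in _ + X]big1 ?addr0 => [|e ef].
    congr (_ * _); rewrite /B /set_row eqxx (bigD1 j0) //= eqxx mul1r.
    by rewrite big1 ?addr0 // => j /negbTE ->; rewrite mul0r.
  by rewrite /B /set_row (negbTE ef) x0A mulr0.
have wf : w f = 0.
  apply/eqP; move: wBx; rewrite big1 => [/esym/eqP|j _].
    by rewrite mulf_eq0 (negbTE x0j) orbF.
  by rewrite wB mul0r.
apply: (indf wf) => j; move: (wB j).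
rewrite /B sum_set_row wf mul0r add0r => h.
by rewrite (bigD1 f) //= wf mul0r add0r.
Qed.

Lemma set_row_right_ker x : right_ker A x -> exists c, forall j, x j = c * x0 j.
Proof.
move=> xA; exists (x j0 / x0 j0) => j; apply/eqP; rewrite -subr_eq0; apply/eqP.
apply: (@left_indep_right_ker B (fun j => x j - x j0 / x0 j0 * x0 j)) => //.
  exact: set_row_left_indep.
move=> e; rewrite /B /set_row; case: eqP => _.
  rewrite (bigD1 j0) //= eqxx mul1r big1 ?addr0; first by field.
  by move=> k /negbTE ->; rewrite mul0r.
under eq_bigr do rewrite mulrBr mulrCA.
by rewrite sumrB xA -mulr_sumr x0A mulr0 subr0.
Qed.

(** Solving with [B] meets every equation except possibly [f]; pairing with [w], nonzero at [f],
    forces that one too. *)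
Lemma left_ker_solve w b : left_ker A w -> w f != 0 -> \sum_e w e * b e = 0 ->
  exists x, forall e, \sum_j A e j * x j = b e.
Proof.
move=> wA wf wb.
have [x xB] := left_indep_solve b set_row_left_indep.
have xA e : e != f -> \sum_j A e j * x j = b e.
  by move=> ef; rewrite -xB /B /set_row (negbTE ef).
exists x => e; have [->|] := eqVneq e f; last exact: xA.
have := left_right_ker A w x; rewrite [RHS]big1 => [|j _]; last by rewrite wA mul0r.
rewrite -[RHS]wb (bigD1 f) //= [in RHS](bigD1 f) //=.
have -> : \sum_(e | e != f) w e * (\sum_j A e j * x j) = \sum_(e | e != f) w e * b e.
  by apply: eq_bigr => k kf; rewrite xA.
by move/addIr/(mulfI wf).
Qed.

End Corank1.
End SquareSystems.

(** * Points avoiding the zeros of finitely many polynomial functions *)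

Section Generic.
Variables (K : numFieldType) (X : Type).
Implicit Types phi psi : (X -> K) -> K.

Definition line (x y : X -> K) (t : K) : X -> K := fun i => x i + t * y i.

(** Polynomiality along lines is all that is needed to join two good points. *)
Definition poly_on_lines phi :=
  forall x y, exists p : {poly K}, forall t, phi (line x y t) = p.[t].

Lemma poly_on_lines_const c : poly_on_lines (fun=> c).
Proof. by move=> x y; exists c%:P => t; rewrite hornerC. Qed.

Lemma poly_on_lines_coord i : poly_on_lines (fun x => x i).
Proof.
by move=> x y; exists ((x i)%:P + 'X * (y i)%:P) => t; rewrite !hornerE.
Qed.

Lemma poly_on_linesM phi psi :
  poly_on_lines phi -> poly_on_lines psi -> poly_on_lines (fun x => phi x * psi x).
Proof.
move=> hf hg x y; have [[p hp] [q hq]] := (hf x y, hg x y).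
by exists (p * q) => t; rewrite hp hq hornerM.
Qed.

Lemma poly_on_linesB phi psi :
  poly_on_lines phi -> poly_on_lines psi -> poly_on_lines (fun x => phi x - psi x).
Proof.
move=> hf hg x y; have [[p hp] [q hq]] := (hf x y, hg x y).
by exists (p - q) => t; rewrite hp hq hornerD hornerN.
Qed.

Lemma poly_on_lines_det n (A : (X -> K) -> 'M[K]_n) :
  (forall i j, poly_on_lines (fun x => A x i j)) -> poly_on_lines (fun x => \det (A x)).
Proof.
move=> hA x y; have [p hp] := fin_all_exists (fun i => fin_all_exists (fun j => hA i j x y)).
exists (\det (\matrix_(i, j) p i j)) => t.
rewrite -[RHS]/(horner_eval t _) -det_map_mx; congr (\det _).
by apply/matrixP => i j; rewrite !mxE /horner_eval hp.
Qed.

Lemma nonroot_nat (p : {poly K}) : p != 0 -> exists n : nat, p.[n%:R] != 0.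
Proof.
move=> p0; pose rs := [seq n%:R : K | n <- iota 0 (size p)].
have : ~~ all (root p) rs.
  apply/negP => /(max_poly_roots p0); rewrite size_map size_iota ltnn => h.
  suff : false by []; apply: h; rewrite map_inj_uniq ?iota_uniq //.
  exact: (mulrIn (oner_neq0 _)).
by rewrite -has_predC => /hasP [_ /mapP [n _ ->]] /= h; exists n.
Qed.

(** By induction on [Q]: on the line from a point good for the head to one good for the tail, both
    restrictions are nonzero polynomials, and some natural number is a root of neither. *)
Lemma generic_point (T : Type) (Q : seq T) (phi : T -> (X -> K) -> K) :
  (forall i, poly_on_lines (phi i)) -> (forall i, exists x, phi i x != 0) ->
  exists x, all (fun i => phi i x != 0) Q.
Proof.
move=> pl ex.
have pl_prod (s : seq T) : poly_on_lines (fun x => \prod_(i <- s) phi i x).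
  elim: s => [|i s ih] x y.
    by exists 1 => t; rewrite big_nil hornerC.
  have [p hp] := poly_on_linesM (pl i) ih x y.
  by exists p => t; rewrite -hp big_cons.
suff [x] : exists x, \prod_(i <- Q) phi i x != 0.
  move=> hx; exists x; move: hx; elim: Q => //= i s ih.
  by rewrite big_cons mulf_eq0 negb_or => /andP [-> /ih].
elim: Q => [|i s [y hy]]; first by exists (fun=> 0); rewrite big_nil oner_neq0.
have [x hx] := ex i.
pose d k := y k - x k.
have line0 : line x d 0 = x.
  by apply: functional_extensionality => k; rewrite /line mul0r addr0.
have line1 : line x d 1 = y.
  by apply: functional_extensionality => k; rewrite /line /d; ring.
have [p hp] := pl i x d.
have [q hq] := pl_prod s x d.
have pq0 : p * q != 0.
  rewrite mulf_neq0 //; [apply: contraNneq hx | apply: contraNneq hy] => e0.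
    by rewrite -line0 hp e0 horner0.
  by rewrite -line1 hq e0 horner0.
have [n hn] := nonroot_nat pq0.
by exists (line x d n%:R); rewrite big_cons hp hq -hornerM.
Qed.
End Generic.

(** * Rado's selection from sums of two subspaces *)

Section Rado.
Variables (K : fieldType) (N : nat) (E : finType).
Implicit Types W : E -> 'M[K]_N.

Definition hall W := [forall F : {set E}, #|F| <= \rank (\sum_(e in F) W e)%MS]%N.

Lemma hallP W :
  reflect (forall F : {set E}, #|F| <= \rank (\sum_(e in F) W e)%MS)%N (hall W).
Proof. exact: forallP. Qed.

Definition upd W a (U : 'M[K]_N) e := if e == a then U else W e.

(* Rado's exchange: if both replacements break Hall's condition, at [F1] and
   [F2] say, then submodularity of rank breaks it at [F1 :|: F2] or at
   [F1 :&: F2 :\ a]. *)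
Lemma hall_upd W a (U1 U2 : 'M[K]_N) : hall W -> (W a <= U1 + U2)%MS ->
  hall (upd W a U1) \/ hall (upd W a U2).
Proof.
move=> hW Wa.
case: (boolP (hall (upd W a U1))) => [|/forallPn [F1]]; first by left.
case: (boolP (hall (upd W a U2))) => [|/forallPn [F2]]; first by right.
rewrite -!ltnNge => h2 h1; exfalso.
have inF U (F : {set E}) : (#|F| > \rank (\sum_(e in F) upd W a U e)%MS)%N -> a \in F.
  apply: contraTT => aF; rewrite -leqNgt.
  rewrite (eq_bigr W); first exact: (hallP _ hW).
  move=> e eF; rewrite /upd ifN //.
  by apply: contraNneq aF => <-.
have a1 := inF _ _ h1; have a2 := inF _ _ h2.
set A := (\sum_(e in F1) upd W a U1 e)%MS in h1.
set B := (\sum_(e in F2) upd W a U2 e)%MS in h2.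
have subW U (F : {set E}) e : e \in F -> e != a -> (W e <= \sum_(e in F) upd W a U e)%MS.
  by move=> eF ea; apply: (sumsmx_sup e); rewrite // /upd (negbTE ea).
have subU U (F : {set E}) : a \in F -> (U <= \sum_(e in F) upd W a U e)%MS.
  by move=> aF; apply: (sumsmx_sup a); rewrite // /upd eqxx.
have hU : (#|F1 :|: F2| <= \rank (A + B)%MS)%N.
  apply: leq_trans (hallP _ hW _) _; apply/mxrankS/sumsmx_subP => e.
  have [-> _|ea] := eqVneq e a.
    by apply: submx_trans Wa _; apply: addsmxS; exact: subU.
  rewrite inE => /orP [] eF.
    by apply: submx_trans (addsmxSl _ _); exact: subW.
  by apply: submx_trans (addsmxSr _ _); exact: subW.
have hI : (#|(F1 :&: F2) :\ a| <= \rank (A :&: B)%MS)%N.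
  apply: leq_trans (hallP _ hW _) _; apply/mxrankS/sumsmx_subP => e.
  rewrite !inE => /and3P [ea e1 e2]; rewrite sub_capmx.
  by apply/andP; split; exact: subW.
(* The union and the intersection without [a] have [#|F1| + #|F2| - 1] elements in total, but the
   ranks of [A + B] and [A :&: B] add up to at most [#|F1| + #|F2| - 2]. *)
have := mxrank_sum_cap A B; have := cardsUI F1 F2.
have := cardsD1 a (F1 :&: F2); rewrite inE a1 a2 /=.
by move: hU hI h1 h2; lia.
Qed.

Lemma hall_choice (U1 U2 : E -> 'M[K]_N) :
  (forall F : {set E}, (#|F| <= \rank (\sum_(e in F) (U1 e + U2 e))%MS)%N) ->
  exists c : E -> bool, (#|E| <= \rank (\sum_e (if c e then U1 e else U2 e))%MS)%N.
Proof.
move=> h.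
(* Edges in [r] are still undecided; [c] records the choice made for the others. *)
pose W (r : seq E) (c : E -> bool) e :=
  if e \in r then (U1 e + U2 e)%MS else if c e then U1 e else U2 e.
have key (r : seq E) c : hall (W r c) -> exists c', hall (W [::] c').
  elim: r c => [|a r ih] c; first by exists c.
  have WE b e : upd (W (a :: r) c) a (if b then U1 a else U2 a) e =
     if (a \in r) && (e == a) then (if b then U1 a else U2 a)
     else W r [eta c with a |-> b] e.
    rewrite /upd /W inE /=; case: (eqVneq e a) => [->|]; last by rewrite andbF.
    by rewrite andbT; case: (a \in r).
  move=> hW; have : (W (a :: r) c a <= U1 a + U2 a)%MS by rewrite /W mem_head.
  have fin b : hall (upd (W (a :: r) c) a (if b then U1 a else U2 a)) ->
     exists c', hall (W [::] c').
    move=> hb; apply: (ih [eta c with a |-> b]); apply/hallP => F.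
    apply: leq_trans (hallP _ hb F) _; apply/mxrankS/sumsmxS => e _.
    rewrite WE; case: andP => // -[ar /eqP ->].
    by rewrite /W ar; case: b {hb}; rewrite ?addsmxSl ?addsmxSr.
  by case/(hall_upd hW) => [/(fin true)|/(fin false)].
have [|c /hallP/(_ setT)] := key (enum E) xpredT.
  apply/hallP => F; apply: leq_trans (h F) _; apply/mxrankS/sumsmxS => e _.
  by rewrite /W mem_enum.
rewrite cardsT => hc; exists c; apply: leq_trans hc _; apply/mxrankS/sumsmx_subP => e _.
by rewrite /W /=; apply: (sumsmx_sup e).
Qed.

End Rado.

(** * Independence read off from a rank *)

Section RowVectors.
Variables (K : fieldType) (E J : finType).

Definition fun_row (g : J -> K) : 'rV[K]_#|J| := \row_j g (enum_val j).

Lemma rank_left_indep (A : E -> J -> K) :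
  (#|E| <= \rank (\sum_e <<fun_row (A e)>>)%MS)%N -> left_indep A.
Proof.
pose M := \matrix_(i < #|E|) fun_row (A (enum_val i)).
move=> h; have fM : row_free M.
  rewrite -row_leq_rank; apply: leq_trans h _; apply/mxrankS/sumsmx_subP => e _.
  rewrite genmxE; have -> : fun_row (A e) = row (enum_rank e) M.
    by rewrite rowK enum_rankK.
  exact: row_sub.
move=> w wA e; have [B MB] := row_freeP fM.
have : (\row_i w (enum_val i)) *m M = 0.
  apply/rowP => j; rewrite !mxE -[RHS](wA (enum_val j)) [RHS]big_enum_val.
  by apply: eq_bigr => i _; rewrite !mxE.
move/(congr1 (mulmx^~ B)); rewrite /= -mulmxA MB mulmx1 mul0mx.
by move/rowP/(_ (enum_rank e)); rewrite !mxE enum_rankK.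
Qed.

End RowVectors.

(** * Graphs with a grounded root and the planes spanned by their edges *)

Section RootedGraph.
Variables (K : fieldType) (I E : finType) (s t : E -> option I).

Definition inc (e : E) (i : I) : K := (s e == Some i)%:R - (t e == Some i)%:R.

(** The condition that edge [e] be orthogonal to [n e]: a rigidity row if [n e] is an edge vector, a
    parallel-drawing row if it is a quarter turn of one. *)
Definition dir_row (n : E * bool -> K) (e : E) (j : I * bool) : K :=
  n (e, j.2) * inc e j.1.

Definition coord_vec (v : option I) (b : bool) : 'rV[K]_#|{: I * bool}| :=
  fun_row (fun j => ((v == Some j.1) && (b == j.2))%:R).

Definition edge_vec (b : bool) (e : E) :=
  fun_row (fun j : I * bool => (b == j.2)%:R * inc e j.1).

Lemma edge_vecE b e : edge_vec b e = coord_vec (s e) b - coord_vec (t e) b.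
Proof.
apply/rowP => j; rewrite !mxE /inc.
by case: (b == _); rewrite ?andbT ?andbF ?mul1r ?mul0r ?subr0.
Qed.

Section Rank.
Variable F : {set E}.

Definition adj : rel (option I) := fun x y =>
  [exists e in F, ((s e == x) && (t e == y)) || ((s e == y) && (t e == x))].

Lemma adj_sym : symmetric adj.
Proof. by move=> x y; apply: eq_existsb => e; rewrite orbC. Qed.

Let csym : connect_sym adj := sym_connect_sym adj_sym.
Let rt := fingraph.root adj.

Lemma adj_edge e : e \in F -> adj (s e) (t e).
Proof. by move=> eF; apply/existsP; exists e; rewrite eF !eqxx. Qed.

(** A component with [k] vertices has at most [2k - 2] edges: by sparsity if it has an edge, and
    because [k] is positive otherwise. The bound is the sum over components. *)
Lemma card_roots_edges :
  (forall F : {set E}, F != set0 -> #|F| + 2 <= 2 * #|span_vs s t F|)%N ->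
  (#|F| + 2 * #|[set r | fingraph.roots adj r]| <= 2 * (#|I| + 1))%N.
Proof.
move=> sparse; set Rt := [set r | _].
have rtR v : rt v \in Rt by rewrite inE; exact: roots_root.
have -> : #|F| = (\sum_(r in Rt) #|[set e in F | rt (s e) == r]|)%N.
  rewrite -sum1_card (partition_big (fun e => rt (s e)) (mem Rt)) //=.
  by apply: eq_bigr => r _; rewrite -sum1_card; apply: eq_bigl => e; rewrite inE.
have -> : (#|I| + 1 = \sum_(r in Rt) #|[set v | rt v == r]|)%N.
  rewrite addn1 -card_option -sum1_card (partition_big rt (mem Rt)) //=.
  by apply: eq_bigr => r _; rewrite -sum1_card; apply: eq_bigl => e; rewrite inE.
rewrite -sum1_card !big_distrr -big_split /=; apply: leq_sum => r rR.
set Fr := [set e in F | _]; have [->|Fr0] := eqVneq Fr set0.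
  rewrite cards0 muln1 add0n -[X in (X <= _)%N]muln1 leq_mul2l /=.
  apply/card_gt0P; exists r; rewrite inE; move: rR; rewrite inE.
  by rewrite /fingraph.roots.
apply: leq_trans (sparse _ Fr0) _; rewrite leq_mul2l /=; apply: subset_leq_card.
apply/subsetP => v; rewrite !inE => /existsP [e]; rewrite inE -andbA.
case/and3P => eF /eqP <- /orP [] /eqP <- //.
by rewrite eq_sym (root_connect csym) connect1 // adj_edge.
Qed.

(** Modulo the edge vectors, the coordinate vectors agree along a component, and those of [None]
    vanish; so adding the planes at the roots of the other components fills the space. *)
Lemma rank_roots :
  (2 * (#|I| + 1) <= \rank (\sum_(e in F) (<<edge_vec true e>> + <<edge_vec false e>>))%MS
    + 2 * #|[set r | fingraph.roots adj r]|)%N.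
Proof.
set Rt := [set r | _].
have rtR v : rt v \in Rt by rewrite inE; exact: roots_root.
set S := (\sum_(e in F) _)%MS.
pose D v := (<<coord_vec v true>> + <<coord_vec v false>>)%MS.
pose T := (S + \sum_(r in Rt :\ rt None) D r)%MS.
have edgeT b e : e \in F -> (edge_vec b e <= T)%MS.
  move=> eF; apply: submx_trans (addsmxSl _ _); apply: (sumsmx_sup e) => //.
  by case: b; [apply: submx_trans (addsmxSl _ _) | apply: submx_trans (addsmxSr _ _)];
    rewrite genmxE.
have cl b : closed adj [pred v | (coord_vec v b <= T)%MS].
  move=> x y /existsP [e /andP [eF]].
  suff h : (coord_vec (s e) b <= T)%MS = (coord_vec (t e) b <= T)%MS.
    by case/orP => /andP [/eqP <- /eqP <-]; rewrite !inE h.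
  have := edgeT b e eF; rewrite edge_vecE => hd; apply/idP/idP => h.
    by rewrite -(subKr (coord_vec (s e) b) (coord_vec _ _)) addmx_sub // eqmx_opp.
  by rewrite -(subrK (coord_vec (t e) b) (coord_vec _ _)) addmx_sub.
have allT v b : (coord_vec v b <= T)%MS.
  have /(closed_connect (cl b)) := connect_root adj v; rewrite !inE => ->.
  have [e0|ne] := eqVneq (rt v) (rt None).
    have /(closed_connect (cl b)) := connect_root adj None; rewrite !inE.
    rewrite /rt in e0; rewrite e0 => <-.
    have -> : coord_vec None b = 0 by apply/rowP => j; rewrite !mxE.
    exact: sub0mx.
  apply: submx_trans (addsmxSr _ _); apply: (sumsmx_sup (rt v)).
    by rewrite in_setD1 ne rtR.
  by case: b; [apply: submx_trans (addsmxSl _ _) | apply: submx_trans (addsmxSr _ _)];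
    rewrite genmxE.
have rT : \rank T = (2 * #|I|)%N.
  rewrite mulnC -[X in (_ * X)%N]card_bool -card_prod; apply/eqP.
  rewrite -[_ == _]/(row_full T) -sub1mx; apply/row_subP => k.
  have -> : row k 1%:M = coord_vec (Some (enum_val k).1) (enum_val k).2 :> 'rV[K]_#|{: I * bool}|.
    apply/rowP => j; rewrite !mxE; congr (_%:R); rewrite -(inj_eq enum_val_inj).
    by case: (enum_val k) (enum_val j) => [a b] [c d].
  exact: allT.
have rDs : (\rank (\sum_(r in Rt :\ rt None) D r)%MS <= 2 * #|Rt :\ rt None|)%N.
  apply: leq_trans (mxrank_sum_leqif _) _ => /=.
  rewrite -[X in (_ <= 2 * X)%N]sum1_card big_distrr /=; apply: leq_sum => r _.
  by rewrite muln1 !genmxE; apply: (leq_add (n1 := 1) (n2 := 1)); exact: rank_leq_row.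
have h : (2 * #|I| <= \rank S + 2 * #|Rt :\ rt None|)%N.
  by rewrite -rT; apply: leq_trans (mxrank_adds_leqif _ _) _; rewrite leq_add2l.
by rewrite (cardsD1 (rt None) Rt) rtR !mulnDr addnCA addnC leq_add2l.
Qed.

End Rank.

(* With directions restricted to the two axes, independence is the statement
   that the edges split into two spanning trees. *)
Lemma sparse_directions :
  (#|E| = 2 * #|I|)%N ->
  (forall F : {set E}, F != set0 -> #|F| + 2 <= 2 * #|span_vs s t F|)%N ->
  exists n, left_indep (dir_row n).
Proof.
move=> cE sparse.
have [F|c hc] := @hall_choice K _ E (fun e => <<edge_vec true e>>%MS)
    (fun e => <<edge_vec false e>>%MS).
  (* Chaining the two bounds through [2 * (#|I| + 1)] cancels the number of components. *)
  have := card_roots_edges F sparse; have := rank_roots F; lia.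
exists (fun eb => (c eb.1 == eb.2)%:R); apply: rank_left_indep.
apply: leq_trans hc _; apply/mxrankS/sumsmx_subP => e _.
apply: (sumsmx_sup e) => //; rewrite /dir_row /=.
by case: (c e); rewrite !genmxE.
Qed.

End RootedGraph.

Lemma orthogonal_plane (K : fieldType) (a b p q : K) :
  (a != 0) || (b != 0) -> p * a + q * b = 0 -> exists c, p = - c * b /\ q = c * a.
Proof.
case/orP => h0 e0; [exists (q / a) | exists (- p / b)].
  split; last by field.
  apply: (mulIf h0); rewrite (_ : _ * b * a = - (q * b)); last by field.
  by apply/eqP; rewrite -addr_eq0 e0.
split; first by field.
apply: (mulIf h0); rewrite (_ : _ * a * b = - (p * a)); last by field.
by apply/eqP; rewrite -addr_eq0 addrC e0.
Qed.

(** * Rigidity rows, rotations and parallel drawings *)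

Section RigidityMatrix.
Variables (K : fieldType) (I E : finType) (s t : E -> option I).

(* [None] is the collapsed pin, fixed at the origin; [true] and [false] index the
   first and second coordinates. *)
Definition ext (x : I * bool -> K) (v : option I) (b : bool) : K :=
  if v is Some i then x (i, b) else 0.

Definition dif x (e : E) b : K := ext x (s e) b - ext x (t e) b.

Definition rig_row (x : I * bool -> K) := dir_row s t (fun eb => dif x eb.1 eb.2).

Definition turn90 (x : I * bool -> K) (j : I * bool) : K :=
  if j.2 then - x (j.1, false) else x (j.1, true).

Lemma dif_turn90 x e b : dif (turn90 x) e b = if b then - dif x e false else dif x e true.
Proof.
by rewrite /dif /ext; case: b; case: (s e) => [?|]; case: (t e) => [?|] /=;
  rewrite /turn90 /=; ring.
Qed.

Lemma sum_dir_row n x e : \sum_j dir_row s t n e j * x j =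
  n (e, true) * dif x e true + n (e, false) * dif x e false.
Proof.
have extE v b : \sum_i (v == Some i)%:R * x (i, b) = ext x v b.
  case: v => [i|] /=; last by rewrite big1 // => i _; rewrite mul0r.
  rewrite (bigD1 i) //= eqxx mul1r big1 ?addr0 // => k ki.
  by rewrite (inj_eq Some_inj) eq_sym (negbTE ki) mul0r.
have difE b : \sum_i n (e, b) * (inc K s t e i * x (i, b)) = n (e, b) * dif x e b.
  rewrite -mulr_sumr; congr (_ * _); rewrite /inc.
  under eq_bigr do rewrite mulrBl.
  by rewrite sumrB !extE.
rewrite -!difE -big_split /=.
rewrite (eq_bigr (fun p : I * bool => dir_row s t n e (p.1, p.2) * x (p.1, p.2))) => [|[]] //.
rewrite -(pair_bigA _ (fun i b => dir_row s t n e (i, b) * x (i, b))) /=.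
by apply: eq_bigr => i _; rewrite big_bool /= /dir_row /= !mulrA.
Qed.

Lemma right_ker_turn90 x : right_ker (rig_row x) (turn90 x).
Proof. by move=> e; rewrite sum_dir_row !dif_turn90 /=; ring. Qed.

(** Every drawing is parallel to itself. *)
Lemma right_ker_parallel x : right_ker (dir_row s t (fun eb => dif (turn90 x) eb.1 eb.2)) x.
Proof. by move=> e; rewrite sum_dir_row !dif_turn90 /=; ring. Qed.

(** A quarter turn of all edges swaps the two equilibrium equations at each vertex, up to sign. *)
Lemma left_ker_parallel x w :
  left_ker (dir_row s t (fun eb => dif (turn90 x) eb.1 eb.2)) w <-> left_ker (rig_row x) w.
Proof.
have turnE i b : \sum_e w e * (dif (turn90 x) e b * inc K s t e i) =
    (-1) ^+ b * \sum_e w e * (dif x e (~~ b) * inc K s t e i).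
  rewrite mulr_sumr; apply: eq_bigr => e _; rewrite dif_turn90.
  by case: b; rewrite /= ?expr1 ?expr0; ring.
split=> h [i b]; have := h (i, ~~ b); last first.
  by rewrite /left_ker /dir_row /= turnE => ->; rewrite mulr0.
rewrite /rig_row /dir_row /= turnE negbK => /eqP.
by rewrite mulf_eq0 signr_eq0 /= => /eqP.
Qed.

End RigidityMatrix.

(** * Generic realizations of a rigidity circuit *)

Section Circuit.
Variables (K : numFieldType) (I E : finType) (s t : E -> option I).
Hypothesis cE : (#|E| = 2 * #|I|)%N.
Hypothesis circ : rigidity_circuit s t.

Lemma card_coords : #|E| = #|{: I * bool}|.
Proof. by rewrite card_prod card_bool cE mulnC. Qed.
Let EJ := card_coords.

Definition redirect (f e : E) (u : E -> option I) g := if g == f then u e else u g.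

(** Reading [f] as [e] turns [F] into [F'], with at most one edge fewer; the circuit bound for
    proper subsets absorbs this loss. [F'] is the full set only if [e = f], where the count for the
    whole circuit suffices. *)
Lemma redirect_sparse f e (F : {set E}) : F != set0 ->
  (#|F| + 2 <= 2 * #|span_vs (redirect f e s) (redirect f e t) F|)%N.
Proof.
move=> F0; pose F' := if f \in F then e |: (F :\ f) else F.
have sub : (#|span_vs s t F'| <= #|span_vs (redirect f e s) (redirect f e t) F|)%N.
  apply/subset_leq_card/subsetP => v; rewrite !inE => /existsP [g /andP [gF' gv]].
  have [gF|gF] := boolP ((g \in F) && (g != f)).
    case/andP: gF => gF gf; apply/existsP; exists g.
    by rewrite gF /redirect (negbTE gf).
  move: gF'; rewrite /F'; case: ifP => [fF|fF gF']; last first.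
    by move: gF; rewrite gF' negbK => /eqP ef; rewrite -ef gF' in fF.
  rewrite !inE andbC (negbTE gF) orbF => /eqP ge.
  by apply/existsP; exists f; rewrite fF /redirect eqxx -ge.
have cF : (#|F| <= #|F'| + 1)%N.
  rewrite /F'; case: ifP => [fF|_]; last by rewrite leq_addr.
  rewrite (cardsD1 f F) fF addnC leq_add2r; apply: subset_leq_card.
  exact: subsetUr.
have F'0 : F' != set0.
  rewrite /F'; case: ifP => // _; apply/set0Pn; exists e; exact: setU11.
have [ET prop] := circ.
have [F'T|F'T] := eqVneq F' setT.
  move: sub; rewrite F'T; have := max_card F.
  by move: ET; lia.
have := prop F' F'0; rewrite properT F'T => /(_ isT).
by move: sub cF; lia.
Qed.

Lemma card_edges_gt0 : (0 < #|E|)%N.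
Proof.
have [+ _] := circ; rewrite lt0n => ET; apply/eqP => E0.
suff S0 : span_vs s t [set: E] = set0 by move: ET; rewrite S0 cards0 E0.
apply/setP => v; rewrite !inE; apply/existsP => -[e _].
by move/card0_eq/(_ e): E0.
Qed.

Lemma generic_directions f : exists n : E * bool -> K,
  forall e, left_indep (dir_row (redirect f e s) (redirect f e t) n).
Proof.
pose A e (n : E * bool -> K) := dir_row (redirect f e s) (redirect f e t) n.
have [|e|n hn] := @generic_point K (E * bool)%type E (enum E)
    (fun e n => \det (sqmx EJ (A e n))).
- move=> e; apply: poly_on_lines_det => i j x y.
  have [p hp] := poly_on_linesM (poly_on_lines_coord
    (enum_val i, (enum_val (cast_ord EJ j)).2))
    (poly_on_lines_const (inc K (redirect f e s) (redirect f e t) (enum_val i)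
       (enum_val (cast_ord EJ j)).1)) x y.
  by exists p => c; rewrite mxE -hp.
- have [n hn] := sparse_directions K cE (redirect_sparse f e).
  by exists n; apply/left_indepP.
exists n => e; apply/(left_indepP EJ); apply: (allP hn).
by rewrite mem_enum.
Qed.

Lemma left_indep_zero_row (A : E -> I * bool -> K) e :
  left_indep A -> ~ (forall j, A e j = 0).
Proof.
move=> iA Ae; have := iA (fun g => (g == e)%:R) _ e; rewrite eqxx.
move=> h; suff /eqP : (1 : K) = 0 by rewrite oner_eq0.
apply: h => j; rewrite big1 // => g _; case: eqP => [->|_]; first by rewrite Ae mulr0.
by rewrite mul0r.
Qed.

(* Whiteley's proof of Laman's theorem: a drawing of [G - f] with generic edge
   directions is unique up to similarity; were an edge [e] of zero length, it
   would also be a drawing of the graph in which [f] doubles [e] with another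
   direction, and that one admits only the trivial drawing. *)
Lemma circuit_delete f : exists m : I * bool -> K,
  (exists j, m j != 0) /\
  forall w, w f = 0 -> left_ker (rig_row s t m) w -> forall e, w e = 0.
Proof.
have [n hn] := generic_directions f.
(* A zero row at [f] makes the square system singular; a kernel vector is a nonzero drawing obeying
   the directions off [f]. *)
pose A0 := set_row (dir_row s t n) f (fun=> 0).
have : \det (sqmx EJ A0) = 0.
  apply/sqmx_left_ker; exists (fun g => (g == f)%:R); last by exists f; rewrite eqxx oner_eq0.
  move=> j; rewrite sum_set_row mulr0 add0r big1 // => g /negbTE ->.
  by rewrite mul0r.
case/sqmx_right_ker => m mA0 m0; exists m; split=> //.
have perp g : g != f -> n (g, true) * dif s t m g true + n (g, false) * dif s t m g false = 0.
  move=> gf; rewrite -sum_dir_row -[RHS](mA0 g).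
  by apply: eq_bigr => j _; rewrite /A0 /set_row (negbTE gf).
have dm e : (dif s t m e true != 0) || (dif s t m e false != 0).
  apply/negPn/negP; rewrite negb_or !negbK => /andP [/eqP dt /eqP df].
  case: m0 => j /eqP; apply; apply: (left_indep_right_ker EJ (hn e)) => g.
  rewrite sum_dir_row; have [->|gf] := eqVneq g f.
    by move: dt df; rewrite /dif /redirect eqxx => -> ->; rewrite !mulr0 addr0.
  by have := perp g gf; rewrite /dif /redirect (negbTE gf).
have redff u : redirect f f u = u.
  by apply: functional_extensionality => g; rewrite /redirect; case: eqP => [->|].
have iN : left_indep (dir_row s t n) by have := hn f; rewrite !redff.
(* In the plane, [n g] is proportional to the quarter turn of the edge [g], so dividing by [c] turns
   stresses of [m] into dependencies of [dir_row s t n]. *)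
have /fin_all_exists [c hc] g : exists c, g != f ->
    [/\ c != 0, n (g, true) = - c * dif s t m g false & n (g, false) = c * dif s t m g true].
  have [_|gf] := eqVneq g f; first by exists 0.
  have [c [nt nf]] := orthogonal_plane (dm g) (perp g gf).
  exists c => _; split=> //; apply/eqP => c0.
  apply: (left_indep_zero_row (e := g) iN) => -[i b]; rewrite /dir_row /=.
  by case: b; rewrite ?nt ?nf c0 ?oppr0 !mul0r.
move=> w wf /left_ker_parallel wA e; apply/eqP.
have [->|ef] := eqVneq e f; first by rewrite wf.
have w'0 : w e / c e = 0.
  apply: (iN (fun g => w g / c g)) => -[i b]; rewrite -[RHS](wA (i, b)).
  apply: eq_bigr => g _; have [->|gf] := eqVneq g f; first by rewrite wf !mul0r.
  have [c0 nt nf] := hc g gf; rewrite /dir_row /= dif_turn90.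
  by case: b; rewrite ?nt ?nf; field.
by have [c0 _ _] := hc e ef; move/eqP: w'0; rewrite mulf_eq0 invr_eq0 (negbTE c0) orbF.
Qed.

(** For each [f] one determinant certifies that no nonzero stress vanishes at [f], and
    [circuit_delete] makes it nonzero somewhere; a generic drawing serves all [f]. Nonzero first
    coordinates will give nonzero velocities. *)
Lemma circuit_realization : exists m : I * bool -> K,
  (forall i, m (i, true) != 0) /\
  (forall f w, w f = 0 -> left_ker (rig_row s t m) w -> forall e, w e = 0).
Proof.
pose A f j0 m := set_row (rig_row s t m) f (fun j => (j == j0)%:R : K).
have /fin_all_exists [jf hj] f : exists j0, exists m, left_indep (A f j0 m).
  have [m [[[i b] mj] hm]] := circuit_delete f.
  (* The pivot is a nonzero coordinate of the rotation, which carries coordinate [b] of [m] to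
     [~~ b]. *)
  exists (i, ~~ b), m; apply: set_row_left_indep hm; first exact: right_ker_turn90.
  by rewrite /turn90 /=; case: b mj => /=; rewrite ?oppr_eq0.
have pext v b : poly_on_lines (fun m : I * bool -> K => ext m v b).
  by case: v => [i|]; [exact: poly_on_lines_coord | exact: poly_on_lines_const].
have [||m hm] := @generic_point K (I * bool)%type (E + I)%type (enum {: E + I})
    (fun k m => match k with inl f => \det (sqmx EJ (A f (jf f) m)) | inr i => m (i, true) end).
- case=> [f|i]; last exact: poly_on_lines_coord.
  apply: poly_on_lines_det => i j x y.
  have [ef|ef] := eqVneq (enum_val i) f.
    exists ((enum_val (cast_ord EJ j) == jf f)%:R)%:P => c.
    by rewrite mxE /A /set_row ef eqxx hornerC.
  have [p hp] := poly_on_linesM (poly_on_linesB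
      (pext (s (enum_val i)) (enum_val (cast_ord EJ j)).2)
      (pext (t (enum_val i)) (enum_val (cast_ord EJ j)).2))
    (poly_on_lines_const (inc K s t (enum_val i) (enum_val (cast_ord EJ j)).1)) x y.
  by exists p => c; rewrite mxE /A /set_row (negbTE ef) -hp.
- case=> [f|i]; last by exists (fun=> 1); rewrite oner_eq0.
  by have [m hm] := hj f; exists m; apply/left_indepP.
exists m; split=> [i|f w wf wA].
  by apply: (allP hm (inr i)); rewrite mem_enum.
have /left_indepP iA : \det (sqmx EJ (A f (jf f) m)) != 0.
  by apply: (allP hm (inl f)); rewrite mem_enum.
apply: iA => j; rewrite /A sum_set_row wf mul0r add0r -[RHS](wA j).
by rewrite [RHS](bigD1 f) //= wf mul0r add0r.
Qed.

(** * Stress and motion of a realized circuit *)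

Section Realized.
Variable m : I * bool -> K.
Hypothesis m0 : forall i, m (i, true) != 0.
Hypothesis indm : forall f w, w f = 0 -> left_ker (rig_row s t m) w -> forall e, w e = 0.

Lemma inner_vertex : exists i : I, true.
Proof. by have := card_edges_gt0; rewrite cE muln_gt0 => /card_gt0P [i _]; exists i. Qed.

(** The rotation is a nonzero right kernel vector of a square matrix, so a nonzero left one exists;
    by [indm] it vanishes nowhere. *)
Lemma realized_stress :
  exists2 w, left_ker (rig_row s t m) w & forall e, w e != 0.
Proof.
have [i _] := inner_vertex.
have /(sqmx_left_ker EJ) [w wA [e we]] : \det (sqmx EJ (rig_row s t m)) = 0.
  apply/sqmx_right_ker; exists (turn90 m); first exact: right_ker_turn90.
  by exists (i, false); exact: m0.
exists w => // f; apply: contraNneq we => wf.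
by apply/eqP; exact: (indm wf).
Qed.

Lemma realized_stress_unique w w' :
  left_ker (rig_row s t m) w -> (forall e, w e != 0) -> left_ker (rig_row s t m) w' ->
  exists c, forall e, w' e = c * w e.
Proof.
move=> wA w0 w'A; have /card_gt0P [f _] := card_edges_gt0.
exists (w' f / w f) => e; apply/eqP; rewrite -subr_eq0; apply/eqP.
apply: (@indm f (fun e => w' e - w' f / w f * w e)).
  by rewrite divfK ?subrr.
move=> j; under eq_bigr do rewrite mulrBl -(mulrA (w' f / w f)).
by rewrite sumrB w'A -mulr_sumr wA mulr0 subr0.
Qed.

Lemma realized_motion_unique x : right_ker (rig_row s t m) x ->
  exists c, forall j, x j = c * turn90 m j.
Proof.
have [i _] := inner_vertex; have /card_gt0P [f _] := card_edges_gt0.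
apply: (set_row_right_ker EJ (f := f) (j0 := (i, false))); first exact: right_ker_turn90.
  exact: m0.
exact: indm.
Qed.

(** A zero-length edge would carry a stress supported on itself alone; another edge exists because
    [#|E|] is even and positive. *)
Lemma realized_edge e : (dif s t m e true != 0) || (dif s t m e false != 0).
Proof.
apply/negPn/negP; rewrite negb_or !negbK => /andP [/eqP dt /eqP df].
have /set0Pn [f] : [set~ e] != set0.
  rewrite -card_gt0; have := cardsC1 e; have := card_edges_gt0.
  by move: cE; lia.
rewrite !inE => fe.
have := indm (f := f) (w := fun g => (g == e)%:R) _ _ e.
rewrite eqxx (negbTE fe) => h; suff /eqP : (1 : K) = 0 by rewrite oner_eq0.
apply: h => // -[i b]; rewrite big1 // => g _; case: eqP => [->|_]; last by rewrite mul0r.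
by rewrite /rig_row /dir_row /=; case: b; rewrite ?dt ?df mul0r mulr0.
Qed.

End Realized.
End Circuit.

(* The forces of [w] at the pins impose one linear condition on pin positions;
   placing them on a line through the origin leaves enough freedom to meet it.
   The edges of [G] can then be drawn parallel to those of the collapsed graph,
   and adding a multiple of the collapsed drawing makes all lengths nonzero. *)
Lemma split_pins (K : numFieldType) (I P E : finType) (src dst : E -> I + P)
    (s := fun e => collapse (src e)) (t := fun e => collapse (dst e))
    (m : I * bool -> K) :
  (#|E| = 2 * #|I|)%N -> rigidity_circuit s t ->
  (forall i, m (i, true) != 0) ->
  (forall f w, w f = 0 -> left_ker (rig_row s t m) w -> forall e, w e = 0) ->
  exists (pos : I + P -> bool -> K) (c : E -> K),
    [/\ forall e, c e != 0,
        forall e b, pos (src e) b - pos (dst e) b = c e * dif s t m e b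
      & forall k l, (forall b, pos (inr k) b = pos (inr l) b) -> k = l].
Proof.
move=> cE circ m0 indm.
have [w wA w0] := realized_stress cE circ m0 indm.
(* Pin [k] will sit at [a (inr k)] times a nonzero vector [v]; the ranks keep the pins distinct. *)
pose a (v : I + P) : K := if v is inr k then (enum_rank k)%:R else 0.
pose beta e := a (src e) - a (dst e).
pose d b e := dif s t m e b.
(* The solvability condition is one linear equation in the two coordinates of [v], so it has a
   nonzero solution. *)
have [v [v0 vL]] : exists v : bool -> K, ((v true != 0) || (v false != 0)) /\
    \sum_e w e * (beta e * (d false e * v true - d true e * v false)) = 0.
  pose L b := \sum_e w e * (beta e * d b e).
  have LE v : \sum_e w e * (beta e * (d false e * v true - d true e * v false)) =
              L false * v true - L true * v false.
    rewrite !mulr_suml -sumrB; apply: eq_bigr => e _; ring.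
  have [L0|] := boolP ((L true != 0) || (L false != 0)); last first.
    rewrite negb_or !negbK => /andP [/eqP Lt /eqP Lf].
    exists (fun=> 1); split; first by rewrite oner_eq0.
    by rewrite (LE (fun=> 1)) Lt Lf !mul0r subr0.
  by exists L; split=> //; rewrite LE; ring.
have [i _] := inner_vertex cE circ; have /card_gt0P [f _] := card_edges_gt0 circ.
(* Equation [e] says that [dif s t x e] plus [beta e] times [v] is parallel to the edge [e] of
   [m]. *)
have [x xA] : exists x, forall e,
    \sum_j dir_row s t (fun eb => dif s t (turn90 m) eb.1 eb.2) e j * x j =
    beta e * (d false e * v true - d true e * v false).
  apply: (left_ker_solve (card_coords cE) (f := f) (j0 := (i, true)) _ _ _ _ (w0 f) vL).
  - exact: right_ker_parallel.
  - exact: m0.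
  - by move=> w' w'f /left_ker_parallel; exact: (indm f).
  - exact/left_ker_parallel.
pose X e b := dif s t x e b + beta e * v b.
have /fin_all_exists [c hc] e : exists c, forall b, X e b = c * d b e.
  have [||c [h1 h2]] := @orthogonal_plane K (d true e) (d false e) (X e false) (- X e true).
  - exact: realized_edge.
  - have := xA e; rewrite sum_dir_row !dif_turn90 /X /d /= => h.
    by move/eqP: h; rewrite -subr_eq0 => /eqP h; rewrite -[RHS]h; ring.
  - by exists (- c) => -[]; rewrite ?h1 // -[LHS]opprK h2 mulNr.
(* Adding [n] copies of [m] shifts every [c e] by [n] and moves no pin; [n] avoids all the
   [- c e]. *)
have [|n hn] := @nonroot_nat K (\prod_e ('X + (c e)%:P)).
  by apply/prodf_neq0 => e _; exact: (monic_neq0 (monicXaddC _)).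
exists (fun u b => ext x (collapse u) b + n%:R * ext m (collapse u) b + a u * v b).
exists (fun e => c e + n%:R); split.
- move=> e; apply: contraNneq hn => e0; rewrite horner_prod (bigD1 e) //=.
  by rewrite hornerD hornerX hornerC addrC e0 mul0r.
- move=> e b; rewrite mulrDl -[c e * _]hc /X /dif /beta; ring.
- move=> k l h; apply: enum_rank_inj; apply/val_inj/eqP; rewrite -(eqr_nat K) /=.
  have {}h b : a (inr k) * v b = a (inr l) * v b.
    by have := h b; rewrite /= mulr0 !add0r.
  by case/orP: v0 => vb; apply/eqP/(mulIf vb)/h.
Qed.

(** * Back from the collapsed drawing to the pinned framework *)

Section Framework.
Variables (I P E : finType) (src dst : E -> I + P).
Let s e := collapse (src e).
Let t e := collapse (dst e).
Variables (m : I * bool -> R) (pos : I + P -> bool -> R) (c : E -> R).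
Hypothesis posE : forall e b, pos (src e) b - pos (dst e) b = c e * dif s t m e b.
Let p v : pt := (pos v true, pos v false).

Lemma collapse_eq (v : I + P) i : (v == inl i) = (collapse v == Some i).
Proof. by case: v. Qed.

Lemma edge_dirE i e : edge_dir src dst p (inl i) e =
  (c e * dif s t m e true * inc R s t e i, c e * dif s t m e false * inc R s t e i).
Proof.
have K0 (a b : bool) (x y : R) : (if a then x - y else 0) + (if b then y - x else 0) =
    (x - y) * (a%:R - b%:R).
  by case: a; case: b; rewrite /=; ring.
rewrite /inc /s /t -!collapse_eq -!posE -!K0 /edge_dir /padd /psub /pzero /p.
by congr (_, _); case: (src e == _); case: (dst e == _).
Qed.

(** Each edge vector of [p] is [c e] times that of [m], and the factor moves into the stress. *)
Lemma stressE w : is_stress src dst p w <-> left_ker (rig_row s t m) (fun e => w e * c e).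
Proof.
split=> [h [i b] | h i].
  have [h1 h2] := h i; case: b; [rewrite -[RHS]h1 | rewrite -[RHS]h2];
  by apply: eq_bigr => e _; rewrite edge_dirE /rig_row /dir_row /= RmultE !mulrA.
split; [rewrite -[RHS](h (i, true)) | rewrite -[RHS](h (i, false))];
  by apply: eq_bigr => e _; rewrite edge_dirE /rig_row /dir_row /= RmultE !mulrA.
Qed.

Definition coords (x : I -> pt) (j : I * bool) : R := if j.2 then (x j.1).1 else (x j.1).2.

Lemma vel_coords x (v : I + P) :
  vel x v = (ext (coords x) (collapse v) true, ext (coords x) (collapse v) false).
Proof. by case: v => //= i; rewrite /coords /=; case: (x i). Qed.

Lemma motionE x : (forall e, c e != 0) ->
  is_motion src dst p x <-> right_ker (rig_row s t m) (coords x).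
Proof.
move=> c0.
have key e : pdot (psub (p (src e)) (p (dst e))) (psub (vel x (src e)) (vel x (dst e))) =
    c e * \sum_j rig_row s t m e j * coords x j.
  rewrite sum_dir_row !vel_coords /pdot /psub /p /= !RplusE !RmultE !RminusE.
  by rewrite !posE /dif; ring.
split=> h e; have := h e; rewrite key; last by move=> ->; rewrite mulr0.
by move/eqP; rewrite mulf_eq0 (negbTE (c0 e)) => /eqP.
Qed.

End Framework.

Theorem theorem3p3 (I P E : finType) (src dst : E -> I + P) :
  assur_graph src dst ->
  exists p : I + P -> pt,
    (forall q1 q2 : P, p (inr q1) = p (inr q2) -> q1 = q2) /\
    (exists w : E -> R,
        is_stress src dst p w /\ (forall e, w e <> R0) /\
        (forall w' : E -> R, is_stress src dst p w' ->
           exists c : R, forall e, w' e = Rmult c (w e))) /\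
    (exists m : I -> pt,
        is_motion src dst p m /\ (forall i, m i <> pzero) /\
        (forall m' : I -> pt, is_motion src dst p m' ->
           exists c : R, forall i, m' i = pscale c (m i))).
Proof.
case=> -[_ [cE _]] circ.
have [m [m0 indm]] := circuit_realization R cE circ.
have [pos [c [c0 posE pos_inj]]] := split_pins cE circ m0 indm.
have [w wA w0] := realized_stress cE circ m0 indm.
exists (fun v => (pos v true, pos v false)); split; [|split].
- by move=> k l [ht hf]; apply: pos_inj => -[].
- exists (fun e => w e / c e); split; [|split].
  + apply/(stressE posE) => j; rewrite -[RHS](wA j).
    by apply: eq_bigr => e _; rewrite divfK.
  + by move=> e; apply/eqP; rewrite mulf_neq0 ?invr_eq0.
  + move=> w' /(stressE posE) /(realized_stress_unique circ indm wA w0) [k hk].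
    exists k => e; rewrite RmultE mulrA -hk.
    by rewrite mulfK.
- exists (fun i => (turn90 m (i, true), turn90 m (i, false))); split; [|split].
  + apply/(motionE posE) => // e; apply: etrans (right_ker_turn90 _ _ m e).
    by apply: eq_bigr => -[i []].
  (* The second component of the velocity at [i] is [m (i, true)]. *)
  + by move=> i [_]; apply/eqP; exact: m0.
  + move=> x /(motionE posE) -/(_ c0) /(realized_motion_unique cE circ m0 indm) [k hk].
    exists k => i; have := hk (i, true); have := hk (i, false).
    by rewrite /coords /pscale /=; case: (x i) => a b /= -> ->.
Qed.
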